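(* Let $G=(X,Y;E)$ be a bipartite graph with parts $X$ and $Y$ such that $\Delta(X) = 2$ and $\Delta(Y) = 3$. Then $\chi'_{st}(G) \leq 5$.
   Context: For a bipartite graph $G=(X,Y;E)$ with parts $X$, $Y$, $\Delta(X)$ and $\Delta(Y)$ denote the maximum degree of the vertices in $X$ and in $Y$, respectively. A star edge coloring of a graph is a proper edge coloring in which there is no path or cycle of length four (i.e., with four edges) whose edges use only two colors. The star chromatic index $\chi'_{st}(G)$ is the minimum number $t$ such that $G$ has a star edge coloring with $t$ colors. *)

(* Defs.v *)
From mathcomp Require Import all_boot.

Set Implicit Arguments.
Unset Strict Implicit.
Unset Printing Implicit Defensive.

Record sgraph := SGraph {
  vertex :> finType;
  adj : rel vertex;
  adj_sym : symmetric adj;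
  adj_irrefl : irreflexive adj }.

Section Graph.
Variable G : sgraph.
Implicit Types (X Y : {set G}).

Definition degree (v : G) : nat := #|[set w | adj v w]|.

Definition max_degree X : nat := \max_(x in X) degree x.

Definition bipartition X Y : Prop :=
  [/\ X :|: Y = setT, [disjoint X & Y] &
      forall u v : G, adj u v -> (u \in X) && (v \in Y) || (u \in Y) && (v \in X)].

Definition edges : {set {set G}} :=
  [set [set uv.1; uv.2] | uv : G * G & adj uv.1 uv.2].

End Graph.

Notation edge G := {e : {set G} | e \in edges G}.

Section StarColoring.
Variable G : sgraph.

(* [es] is the sequence of edges {x, p_0}, {p_0, p_1}, ... *)
Definition traverses (es : seq (edge G)) (x : G) (p : seq G) : bool :=
  [seq val e | e <- es] == pairmap (fun u v => [set u; v]) x p.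

Definition is_path (es : seq (edge G)) : bool :=
  [exists x : G, exists p : (size es).-tuple G,
    [&& path (@adj G) x p, uniq (x :: p) & traverses es x p]].

Definition is_cycle (es : seq (edge G)) : bool :=
  (2 < size es) &&
  [exists x : G, exists p : (size es).-1.-tuple G,
    ucycleb (@adj G) (x :: p) && traverses es x (rcons p x)].

Section Coloring.
Variables (t : nat) (c : {ffun edge G -> 'I_t}).

Definition proper_edge_coloring : bool :=
  [forall e : edge G, forall f : edge G,
    (e != f) && ~~ [disjoint val e & val f] ==> (c e != c f)].

Definition bicolored (es : seq (edge G)) : bool :=
  #|[set c e | e in es]| <= 2.

Definition star_edge_coloring : bool :=
  proper_edge_coloring &&
  [forall es : 4.-tuple (edge G), is_path es || is_cycle es ==> ~~ bicolored es].

End Coloring.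

Definition star_edge_colorable (t : nat) : bool :=
  [exists c : {ffun edge G -> 'I_t}, star_edge_coloring c].

Lemma path_cycle_uniq (es : 4.-tuple (edge G)) :
  is_path es || is_cycle es -> uniq es.
Proof.
have setP2 (a b d f : G) : [set a; b] == [set d; f] ->
    ((a == d) || (a == f)) && ((b == d) || (b == f)).
  by move/eqP/setP=> E; move: (E a) (E b); rewrite !inE !eqxx orbT /= => <- <-.
rewrite -(map_inj_uniq val_inj) => /orP[|/andP[_]] /existsP[x] /existsP[p].
  case/and3P=> _ Hu /eqP->; move: Hu.
  have: size p = 4 by rewrite size_tuple size_tuple.
  case: (tval p) => [|a [|b [|d [|f []]]]] //= _.
  rewrite !inE !negb_or -!andbA.
  case/and5P=> xa xb xd xf /and5P[ab ad af bd] /and3P[bf df _].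
  rewrite !andbT; apply/and5P; split; try apply/andP; try split;
    apply/negP=> /setP2;
    rewrite ?[a == x]eq_sym ?[b == x]eq_sym ?[b == a]eq_sym ?[d == x]eq_sym ?[d == a]eq_sym
      ?(negPf xa) ?(negPf xb) ?(negPf xd) ?(negPf xf) ?(negPf ab) ?(negPf ad)
      ?(negPf af) ?(negPf bd) ?(negPf bf) ?(negPf df) ?andbF //.
case/andP=> /andP[_ Hu] /eqP->; move: Hu.
have: size p = 3 by rewrite size_tuple size_tuple.
case: (tval p) => [|a [|b [|d []]]] //= _.
rewrite !inE !negb_or -!andbA.
case/and5P=> xa xb xd ab /and3P[ad bd _].
rewrite !andbT; apply/and5P; split; try apply/andP; try split;
  apply/negP=> /setP2;
  rewrite ?[a == x]eq_sym ?[b == x]eq_sym ?[b == a]eq_sym ?[d == x]eq_sym ?[d == a]eq_sym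
    ?(negPf xa) ?(negPf xb) ?(negPf xd) ?(negPf ab) ?(negPf ad)
    ?(negPf bd) ?andbF //.
Qed.

Lemma star_edge_colorable_exists : exists t, star_edge_colorable t.
Proof.
exists #|{: edge G}|; apply/existsP; exists [ffun e => enum_rank e].
apply/andP; split.
  apply/'forall_forallP=> e f; apply/implyP=> /andP[nef _].
  by rewrite !ffunE (inj_eq enum_rank_inj).
apply/forallP=> es; apply/implyP=> /path_cycle_uniq Hu.
rewrite /bicolored card_imset; last by move=> e f; rewrite !ffunE => /enum_rank_inj.
by rewrite (card_uniqP Hu) size_tuple.
Qed.

Definition star_chromatic_index : nat := ex_minn star_edge_colorable_exists.

End StarColoring.

(* Main.v *)
Require Import Defs.
From mathcomp Require Import all_boot zify.

Set Implicit Arguments.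
Unset Strict Implicit.
Unset Printing Implicit Defensive.

(** Read [G] as a multigraph [H] on [Y] whose edges are the vertices of [X].
Let every [y] of degree 3 pick an incident edge [p y], no edge being picked
twice. Then [y -> other end of p y] is a functional graph; if it has no odd
cycle, the edges [y (p y)] of [G] can be colored with 3 and 4 so that two of
them joined by an edge of [G] get different colors, and no bicolored path of
length four uses the color 3 or 4. Such a choice grows from the empty set: attach to the
current set [S] a new vertex linked to it or, when there is none, a vertex with
at most two neighbors, a vertex with a pendant edge, or else an even cycle,
which exists since the rest of [H] then has minimum degree 3.

As in a depth-first search, one attaches to a vertex nobody points at whenever
possible; then no two vertices that nobody points at are adjacent in [H]. So the
remaining edges of [G] form paths with at most six edges, and these
are colored with 0, 1, 2 by an explicit local rule. *)

(** * Star edge colorings from a function on ordered pairs *)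

Lemma set2_eq (T : finType) (a b c d : T) :
  [set a; b] = [set c; d] -> (a = c /\ b = d) \/ (a = d /\ b = c).
Proof.
move=> E.
have /set2P ha : a \in [set c; d] by rewrite -E set21.
have /set2P hb : b \in [set c; d] by rewrite -E set22.
have /set2P hc : c \in [set a; b] by rewrite E set21.
have /set2P hd : d \in [set a; b] by rewrite E set22.
by case: ha => ?; case: hb => ?; subst; auto; case: hc; case: hd; auto.
Qed.

(** In a proper coloring, a bicolored path or cycle with four edges alternates its two colors. As
    [u = a] is allowed, the last hypothesis covers cycles too. *)
Lemma star_chromatic_index_le (G : sgraph) (t : nat) (d : G -> G -> 'I_t.+1) :
  (forall u v, adj u v -> d u v = d v u) ->
  (forall u v w, adj u v -> adj v w -> u != w -> d u v != d v w) ->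
  (forall u v w z a, adj u v -> adj v w -> adj w z -> adj z a ->
     u != w -> v != z -> w != a -> d u v = d w z -> d v w = d z a -> False) ->
  star_chromatic_index G <= t.+1.
Proof.
move=> dC dP dS.
rewrite /star_chromatic_index; case: ex_minnP => m _; apply.
(* An edge is an unordered pair: [dC] makes the picked orientation harmless, and [ord0] is never
   reached. *)
pose c : {ffun edge G -> 'I_t.+1} := [ffun e =>
  if [pick uv : G * G | val e == [set uv.1; uv.2]] is Some uv
  then d uv.1 uv.2 else ord0].
have cE (e : edge G) u v : adj u v -> val e = [set u; v] -> c e = d u v.
  rewrite ffunE => uv E; case: pickP => [[a b] /= /eqP|/(_ (u, v))]; last by rewrite /= E eqxx.
  by rewrite E => /set2_eq[] [<- <-] //; rewrite -dC.
apply/existsP; exists c; apply/andP; split.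
  apply/'forall_forallP => e f; apply/implyP => /andP[ef].
  rewrite -setI_eq0 => /set0Pn [v /setIP[ve vf]].
  have endE (g : edge G) : v \in val g -> exists2 u, val g = [set u; v] & adj u v.
    case/imsetP: (valP g) => -[a b]; rewrite inE /= => ab ->.
    case/set2P=> ->; [exists b; first exact: setUC; by rewrite adj_sym | by exists a].
  have [u eE uv] := endE _ ve; have [w fE wv] := endE _ vf.
  rewrite (cE _ _ _ uv eE) (cE _ v w) 1?setUC //; last by rewrite adj_sym.
  apply: dP => //; first by rewrite adj_sym.
  by apply: contraNneq ef => uw; apply/eqP/val_inj; rewrite /= eE fE uw.
apply/forallP => es; apply/implyP => esP; apply/negP => bic.
have [u [v [w [z [a [/and4P[uv vw wz za] /and3P[uw vz wa] tr]]]]]] :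
  exists u v w z a, [/\ [&& adj u v, adj v w, adj w z & adj z a],
    [&& u != w, v != z & w != a] & traverses es u [:: v; w; z; a]].
  case/orP: esP => [|/andP[_]] /existsP[x] /existsP[p].
    have: size p = 4 by rewrite size_tuple size_tuple.
    case: (tval p) => [|v [|w [|z [|a []]]]] //= _ /and3P[/and5P[? ? ? ? _] + tr].
    rewrite !inE !negb_or -!andbA => /and5P[_ uw _ _ /and5P[_ vz _ _ /andP[wa _]]].
    by exists x, v, w, z, a; split=> //; [apply/and4P | apply/and3P].
  have: size p = 3 by rewrite size_tuple size_tuple.
  case: (tval p) => [|v [|w [|z []]]] //= _ /andP[/andP[/and5P[? ? ? ? _] +] tr].
  rewrite /= !inE !negb_or -!andbA => /and5P[_ uw _ _ /and3P[vz _ _]].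
  by exists x, v, w, z, x; split=> //; [apply/and4P | apply/and3P; split; rewrite // eq_sym].
have: size es = 4 by rewrite size_tuple.
move: tr bic; rewrite /traverses /bicolored.
case: (tval es) => [|e1 [|e2 [|e3 [|e4 []]]]] //= /eqP[E1 E2 E3 E4] bic _.
have := dS _ _ _ _ _ uv vw wz za uw vz wa.
have := dP _ _ _ wz za wa; have := dP _ _ _ vw wz vz; have := dP _ _ _ uv vw uw.
rewrite -(cE _ _ _ uv E1) -(cE _ _ _ vw E2) -(cE _ _ _ wz E3) -(cE _ _ _ za E4) => n12 n23 n34 n.
(* Two distinct colors exhaust a set of at most two. *)
have sub2 (x y z' : 'I_t.+1) : x != y ->
    [set x; y; z'] \subset [set c e | e in [:: e1; e2; e3; e4]] -> (z' == x) || (z' == y).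
  move=> xy /subset_leq_card/leq_trans/(_ bic); apply: contraTT.
  by rewrite negb_or -ltnNge => /andP[zx zy]; rewrite setUC cardsU1 !inE negb_or zx zy cards2 xy.
have mem e : e \in [:: e1; e2; e3; e4] -> c e \in [set c e | e in [:: e1; e2; e3; e4]].
  by move=> he; apply/imsetP; exists e.
apply: n.
  have := sub2 (c e1) (c e2) (c e3) n12.
  rewrite !subUset !sub1set !mem ?inE ?eqxx ?orbT // => /(_ isT).
  by rewrite [c e3 == c e2]eq_sym (negPf n23) orbF => /eqP.
have := sub2 (c e2) (c e3) (c e4) n23.
rewrite !subUset !sub1set !mem ?inE ?eqxx ?orbT // => /(_ isT).
by rewrite [c e4 == c e3]eq_sym (negPf n34) orbF => /eqP.
Qed.

(** * Even cycles under minimum degree three *)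

(** If a path cannot be extended beyond its end [x], all neighbors of [x] in [A] lie on it. Besides
    the next vertex there are two more, at positions [i < j]. They close cycles of lengths [i + 1],
    [j + 1] and [j - i + 2], one of which is even. *)
Lemma even_cycle (T : finType) (e : rel T) (A : {set T}) :
  symmetric e -> irreflexive e -> A != set0 ->
  {in A, forall x, 2 < #|[set y in A | e x y]|} ->
  exists c, [/\ ucycle e c, {subset c <= A}, ~~ odd (size c) & 2 < size c].
Proof.
move=> eC e0 /set0Pn[x0 Ax0] deg.
(* The path grows at its front [x]; [n] bounds the extensions left. *)
suff H n x p : path e x p -> uniq (x :: p) -> {subset x :: p <= A} -> #|T| <= size p + n ->
    exists c, [/\ ucycle e c, {subset c <= A}, ~~ odd (size c) & 2 < size c].
  by apply: (H #|T| x0 [::]) => // x; rewrite inE => /eqP->.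
elim: n x p => [|n IH] x p ep up sp szp.
  by move: (max_card (mem (x :: p))); rewrite (card_uniqP up) => /leq_trans/(_ szp); rewrite addn0 ltnn.
have xA : x \in A by rewrite sp ?mem_head.
have [/existsP[z /and3P[zA xz zp]]|/existsPn noz] :=
  boolP [exists z, [&& z \in A, e x z & z \notin x :: p]].
  apply: (IH z (x :: p)).
  - by rewrite /= eC xz.
  - by rewrite cons_uniq zp.
  - by move=> w; rewrite inE => /predU1P[->|/sp].
  by rewrite addSnnS.
pose N := [set y in A | e x y].
have Np z : z \in N -> z \in p.
  rewrite inE => /andP[zA xz]; have := noz z; rewrite zA xz negbK inE => /predU1P[zx|//].
  by rewrite zx e0 in xz.
(* Discarding the successor [h] of [x] leaves positions at least 2, hence cycles with at least three
   vertices. *)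
pose h := head x p.
have cardN : 1 < #|N :\ h|.
  by have := deg x xA; rewrite -/N (cardsD1 h); case: (_ \in _); lia.
pose v i := nth x (x :: p) i.
have hyp i j : 1 < i < j -> j < size (x :: p) -> e x (v i) -> e x (v j) -> 
    exists c, [/\ ucycle e c, {subset c <= A}, ~~ odd (size c) & 2 < size c].
  move=> ij js exi exj.
  have base k : 1 < k < size (x :: p) -> odd k -> e x (v k) -> 
    exists c, [/\ ucycle e c, {subset c <= A}, ~~ odd (size c) & 2 < size c].
    case/andP=> k1 ks ok exk; exists (x :: take k p).
    have sk : size (take k p) = k by rewrite size_takel.
    rewrite /= sk ok; split=> //; last first.
      by move=> y; rewrite inE => /predU1P[->//|/mem_take yp]; rewrite sp // inE yp orbT.
    apply/andP; split; last exact: (take_uniq k.+1 up).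
    rewrite /cycle rcons_path take_path //= (last_nth x) sk eC.
    by rewrite -[x :: take k p]/(take k.+1 (x :: p)) nth_take.
  have [oi|ei] := boolP (odd i); first by apply: (base i); lia.
  have [oj|ej] := boolP (odd j); first by apply: (base j); lia.
  pose q := take (j - i).+1 (drop i (x :: p)).
  have sq : size q = (j - i).+1 by rewrite size_takel // size_drop; lia.
  have qE k : k <= j - i -> nth x q k = v (i + k).
    by move=> kj; rewrite nth_take // nth_drop.
  exists (x :: q); rewrite /= sq; split; last by lia.
  - apply/andP; split.
      have pq : path e x q.
        apply/(pathP x) => -[|k]; rewrite sq => kl; first by rewrite /= qE ?addn0.
        rewrite /= qE ?qE; [|lia..].
        have /(pathP x)/(_ (i + k)) := ep; rewrite addnS /v /=; apply.
        by move: js => /=; lia.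
      by rewrite /cycle rcons_path pq (last_nth x) sq /= qE // subnKC 1?eC //; lia.
    rewrite /= take_uniq ?drop_uniq // andbT; apply/negP => /mem_take.
    case: i ij {base exi ei q sq qE} => [|i] ij; first by lia.
    by move=> xp; case/andP: up => /negP[]; apply: (@mem_drop i).
  - move=> y; rewrite inE => /predU1P[->|yq]; first exact: xA.
    by apply: sp; apply: (@mem_drop i); exact: mem_take yq.
  by lia.
have [y [z [yN zN yz]]] : exists y z, [/\ y \in N :\ h, z \in N :\ h & y != z].
  by case/card_gt1P: cardN => y [z [? ? ?]]; exists y, z.
have wit w : w \in N :\ h -> exists i, [/\ 1 < i, i < size (x :: p), w = v i & e x (v i)].
  case/setD1P => wh wN; have wp := Np _ wN.
  exists (index w p).+1; rewrite /= /v /= nth_index // !ltnS index_mem wp; split=> //.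
    rewrite lt0n; apply: contra wh => /eqP i0.
    by rewrite /h -nth0 -i0 nth_index.
  by move: wN; rewrite inE => /andP[].
have [i [i1 ip yi ei]] := wit y yN; have [j [j1 jp zj ej]] := wit z zN.
case: (ltngtP i j) => ij.
- by apply: (hyp i j); rewrite ?i1.
- by apply: (hyp j i); rewrite ?j1.
by rewrite yi zj ij eqxx in yz.
Qed.

Lemma index_next (T : eqType) (c : seq T) y : uniq c -> y \in c ->
  index (next c y) c = if (index y c).+1 < size c then (index y c).+1 else 0.
Proof.
case: c => // x0 c uc yc; rewrite next_nth yc.
set i := index y _; have ic : i < size (x0 :: c) by rewrite index_mem.
rewrite [size _]/= ltnS; case: ltnP => ci.
  by rewrite -[nth x0 c i]/(nth x0 (x0 :: c) i.+1) index_uniq.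
by rewrite nth_default //= eqxx.
Qed.

(** * Vertices of [X] as edges of a multigraph on [Y] *)

Section Picks.
Variables (G : sgraph) (X Y : {set G}).
Hypothesis bip : bipartition X Y.
Hypothesis degX : {in X, forall x, degree x <= 2}.

Lemma adjYX y x : y \in Y -> adj y x -> x \in X.
Proof.
case: bip => _ dXY H yY /H; rewrite yY (disjointFl dXY yY) /=.
by case: (x \in X).
Qed.

Lemma adjXY x y : x \in X -> adj x y -> y \in Y.
Proof.
case: bip => _ dXY H xX /H; rewrite xX (disjointFr dXY xX) /= orbF.
by case: (y \in Y).
Qed.

Lemma notXY x : x \in X -> x \notin Y.
Proof. by case: bip => _ dXY _ xX; rewrite (disjointFr dXY xX). Qed.

Lemma nadjYY y z : y \in Y -> z \in Y -> adj y z = false.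
Proof. by move=> yY zY; apply/negP => /(adjYX yY)/notXY; rewrite zY. Qed.

Lemma size_le_degree (v : G) s : uniq s -> all (adj v) s -> size s <= degree v.
Proof.
move=> us /allP sv; rewrite -(card_uniqP us); apply/subset_leq_card/subsetP => w.
by rewrite inE => /sv.
Qed.

Lemma other_end x u v w : x \in X -> adj u x -> adj v x -> adj w x -> u != v -> w != u -> w = v.
Proof.
move=> xX ux vx wx uv wu; apply/eqP; apply: contraTT (degX xX) => wv; rewrite -ltnNge.
by apply: (@size_le_degree x [:: w; u; v]); rewrite /= ?inE ?negb_or ?wu ?wv ?uv // !(adj_sym x) wx ux vx.
Qed.

(** * Choice of the picked edges *)

(** Some other vertex points at [y]: the edge of the multigraph that it picks ends at [y]. *)
Definition hit (S : {set G}) (p : G -> G) y := [exists w in S, (w != y) && adj y (p w)].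

Definition boundary (S : {set G}) u := [exists x, exists z, [&& adj u x, adj x z & z \notin S]].

(* [p y = y] encodes that [y] picks no edge. The last field is what keeps
[pick_unhit] true when a new vertex is attached. *)
Record pick_state (S : {set G}) (p : G -> G) (s : G -> bool) : Prop := PickState {
  pick_sub : {subset S <= Y};
  pick_adj : {in S, forall y, adj y (p y) \/ p y = y /\ degree y <= 2};
  pick_inj : {in S &, injective p};
  pick_alt : forall y z, y \in S -> adj y (p y) -> adj z (p y) -> z != y -> z \in S /\ s z != s y;
  pick_unhit : forall u v x, u \in S -> v \in S -> ~~ hit S p u -> ~~ hit S p v ->
    adj u x -> adj v x -> u = v;
  pick_boundary : forall u v, u \in S -> v \in S -> ~~ hit S p u -> ~~ hit S p v ->
    boundary S u -> boundary S v -> u = v }.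

Lemma hit_extend (S T : {set G}) p q v : {in T, forall y, y \notin S} ->
  hit S p v -> hit (S :|: T) (fun y => if y \in T then q y else p y) v.
Proof.
move=> TS /exists_inP[w wS wv]; apply/exists_inP; exists w; first by rewrite inE wS.
by rewrite ifN //; apply: contraL wS => /TS.
Qed.

(** Growing a state is reduced to conditions on the new block [T]. The last hypothesis serves both
    [pick_unhit] and [pick_boundary]: if a neighbor [x] of [v] in [S] is also adjacent to a vertex
    of [T], then [v] is on the boundary of [S]. *)
Lemma pick_extend S p s (T : {set G}) q t :
    let S' := S :|: T in
    let p' y := if y \in T then q y else p y in
    let s' y := if y \in T then t y else s y in
    pick_state S p s -> {subset T <= Y} -> {in T, forall y, y \notin S} ->
    {in T, forall y, adj y (q y) \/ q y = y /\ degree y <= 2} -> {in T &, injective q} ->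
    (forall y z, y \in T -> adj y (q y) -> adj z (q y) -> z != y ->
       z \in T /\ t z != t y \/ z \in S /\ s z != t y) ->
    (forall u v, u \in T -> v \in T -> ~~ hit S' p' u -> ~~ hit S' p' v -> u = v) ->
    (forall u v, u \in T -> v \in S -> ~~ hit S' p' u -> ~~ hit S' p' v -> ~~ boundary S v) ->
  pick_state S' p' s'.
Proof.
move=> S' p' s' [sub Hadj inj alt unhit bnd] TY TS Tadj Tinj Talt Thit Tbnd.
have ST y : y \in S -> y \in T = false by move=> yS; apply: contraTF yS => /TS.
have p'S y : y \in S -> p' y = p y by move=> yS; rewrite /p' ST.
have p'T y : y \in T -> p' y = q y by rewrite /p' => ->.
have hitS v : ~~ hit S' p' v -> ~~ hit S p v.
  by apply: contra; apply: hit_extend.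
have bndS v : boundary S' v -> boundary S v.
  case/existsP=> x /existsP[z /and3P[vx xz]]; rewrite inE negb_or => /andP[zS _].
  by apply/existsP; exists x; apply/existsP; exists z; rewrite vx xz.
(* If both picks are edges, [z] would be the other end of an old pick, hence in [S] by
   [pick_alt]. *)
have injST y z : y \in S -> z \in T -> p y <> q z.
  move=> yS zT E; have [yY zY] := (sub _ yS, TY _ zT).
  have zy : z != y by apply: contraNneq (TS _ zT) => ->.
  case: (Hadj _ yS) (Tadj _ zT) => [yp|[yp _]] [zq|[zq _]].
  - by have [] := alt y z yS yp _ zy; rewrite ?E // (negPf (TS _ zT)).
  - by rewrite E zq nadjYY in yp.
  - by rewrite -E yp nadjYY in zq.
  - by rewrite -zq -E yp eqxx in zy.
split.
- by move=> y /setUP[/sub|/TY].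
- by move=> y /setUP[yS|yT]; [rewrite p'S //; apply: Hadj | rewrite p'T //; apply: Tadj].
- move=> y z /setUP[yS|yT] /setUP[zS|zT].
  + by rewrite !p'S //; apply: inj.
  + by rewrite p'S // p'T // => /injST; case.
  + by rewrite p'T // p'S // => /esym/injST; case.
  + by rewrite !p'T //; apply: Tinj.
- move=> y z /setUP[yS|yT].
    rewrite p'S // => yp zp zy.
    have [zS sz] := alt y z yS yp zp zy.
    by rewrite inE zS /s' !ST.
  rewrite p'T // => yp zp zy.
  have [[zT tz]|[zS sz]] := Talt y z yT yp zp zy; first by rewrite inE zT orbT /s' zT yT.
  by rewrite inE zS /s' ST // yT.
- move=> u v x /setUP[uS|uT] /setUP[vS|vT] hu hv ux vx.
  + by apply: (unhit u v x) => //; apply: hitS.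
  + case/negP: (Tbnd v u vT uS hv hu); apply/existsP; exists x; apply/existsP; exists v.
    by rewrite ux adj_sym vx TS.
  + case/negP: (Tbnd u v uT vS hu hv); apply/existsP; exists x; apply/existsP; exists u.
    by rewrite vx adj_sym ux TS.
  + exact: Thit.
- move=> u v /setUP[uS|uT] /setUP[vS|vT] hu hv bu bv.
  + by apply: bnd; auto.
  + by case/negP: (Tbnd v u vT uS hv hu); apply: bndS.
  + by case/negP: (Tbnd u v uT vS hu hv); apply: bndS.
  + exact: Thit.
Qed.

(** On an even cycle each vertex picks the edge to its successor and is hit by its predecessor; [t]
    is the parity of the position. *)
Lemma even_cycle_pick (A : {set G}) :
    {subset A <= Y} -> A != set0 -> {in A, forall y, 2 < degree y} ->
    (forall y x, y \in A -> adj y x -> exists2 z, z \in A & (z != y) && adj z x) ->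
  exists T q t, [/\ T != set0, {subset T <= A}, {in T, forall y, adj y (q y)}, {in T &, injective q} &
    (forall y z, y \in T -> adj z (q y) -> z != y -> z \in T /\ t z != t y :> bool) /\
    {in T, forall y, exists2 w, w \in T & (w != y) && adj y (q w)}].
Proof.
move=> AY A0 deg oth.
have inX y x : y \in A -> adj y x -> x \in X by move=> /AY; apply: adjYX.
(* Two parallel edges already form an even cycle, of length two; each end picks one of them. *)
have [|simple] := boolP [exists y in A, exists z in A, exists x, exists x',
  [&& y != z, x != x', adj y x && adj y x' & adj z x && adj z x']].
  case/exists_inP=> y yA /exists_inP[z zA] /existsP[x /existsP[x']].
  case/and4P=> yz xx' /andP[yx yx'] /andP[zx zx'].
  exists [set y; z], (fun w => if w == y then x else x'), (pred1 y).
  have zy : z == y = false by rewrite eq_sym (negPf yz).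
  split.
  - by apply/set0Pn; exists y; rewrite set21.
  - by move=> w /set2P[] ->.
  - by move=> w /set2P[] ->; rewrite ?eqxx ?zy.
  - move=> u v /set2P[] -> /set2P[] ->; rewrite ?eqxx ?zy // => E.
      by rewrite E eqxx in xx'.
    by rewrite E eqxx in xx'.
  split=> [u v /set2P[] -> | u /set2P[] ->]; rewrite ?eqxx ?zy /= ?zy ?eqxx.
  - move=> vx vy; have -> : v = z by apply: (other_end (inX _ _ yA yx)) vx _ vy.
    by rewrite set22 zy.
  - move=> vx vz; have -> : v = y by apply: (other_end (inX _ _ yA yx')) vx _ vz; rewrite ?zy.
    by rewrite set21 eqxx.
  - by exists z; rewrite ?set22 ?zy.
  - by exists y; rewrite ?set21 ?yz ?eqxx.
pose e (y z : G) := (y != z) && [exists x, adj y x && adj z x].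
have eC : symmetric e.
  by move=> y z; rewrite /e eq_sym; congr (_ && _); apply: eq_existsb => x; rewrite andbC.
have e0 : irreflexive e by move=> y; rewrite /e eqxx.
have degE : {in A, forall y, 2 < #|[set z in A | e y z]|}.
  (* [o x] is the other end of the edge [x], the default being unreached when [x] is adjacent to
     [y]. Without parallel edges [o] is injective, so passing to the simple graph [e] loses no
     degree. *)
  move=> y yA; pose o x := odflt y [pick z | [&& z \in A, z != y & adj z x]].
  have oP x : adj y x -> [/\ o x \in A, o x != y & adj (o x) x].
    move=> yx; rewrite /o; case: pickP => [z /and3P[]//|].
    by have [z zA /andP[zy zx]] := oth y x yA yx; move/(_ z); rewrite zA zy zx.
  apply: leq_trans (deg y yA) _; rewrite /degree -(card_in_imset (f := o)).
    apply/subset_leq_card/subsetP => z /imsetP[x]; rewrite !inE => yx ->.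
    have [-> oy ox] := oP x yx; rewrite /e eq_sym oy /=.
    by apply/existsP; exists x; rewrite yx.
  move=> x x'; rewrite !inE => yx yx' E; apply: contraNeq simple => xx'.
  have [oA oy ox] := oP x yx; have [_ _ ox'] := oP x' yx'.
  apply/exists_inP; exists y => //; apply/exists_inP; exists (o x) => //.
  by apply/existsP; exists x; apply/existsP; exists x'; rewrite eq_sym oy xx' yx yx' ox E ox'.
have [c [/andP[cc uc] cA ce cs]] := even_cycle eC e0 A0 degE.
pose n y := next c y.
have nc y : y \in c -> n y \in c by rewrite mem_next.
have ne y : y \in c -> e y (n y) by move=> yc; apply: next_cycle.
have ny y : y \in c -> n y != y by move=> /ne/andP[]; rewrite eq_sym.
(* This needs a cycle longer than two, and keeps neighbors on the cycle from picking the same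
   edge. *)
have nny y : y \in c -> n (n y) != y.
  move=> yc; apply/eqP => /(congr1 (index^~ c)); rewrite index_next ?nc // index_next //.
  have := yc; rewrite -index_mem; move: (index y c) => i ic.
  by case: (ltnP i.+1 (size c)) => i1; [case: (ltnP i.+2 (size c)) | rewrite (ltnW cs)]; lia.
(* The even length makes the parity alternate at the wrap-around as well. *)
have par y : y \in c -> odd (index (n y) c) != odd (index y c).
  move=> yc; rewrite index_next //; have := yc; rewrite -index_mem; move: (index y c) => i ic.
  by case: ltnP => i1; lia.
pose q y := odflt y [pick x | adj y x && adj (n y) x].
have qP y : y \in c -> adj y (q y) /\ adj (n y) (q y).
  move/ne=> /andP[_ /existsP[x yx]]; rewrite /q; case: pickP => [z /andP[]//|/(_ x)].
  by rewrite yx.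
have qX y : y \in c -> q y \in X.
  by move=> yc; have [yq _] := qP y yc; apply: inX yq; apply: cA.
have qn y z : y \in c -> adj z (q y) -> z != y -> z = n y.
  move=> yc zq zy; have [yq nq] := qP y yc.
  by apply: (other_end (qX y yc)) zq _ zy => //; rewrite eq_sym ny.
exists [set y in c], q, (fun y => odd (index y c)); split.
- by case: c {ce cc uc cA n nc ne ny nny par q qP qX qn} cs => // y c _; apply/set0Pn; exists y; rewrite inE mem_head.
- by move=> y; rewrite inE => /cA.
- by move=> y; rewrite inE => /qP[].
- move=> y z; rewrite !inE => yc zc E; apply/eqP; apply: contraT => yz.
  have [yq _] := qP y yc; have [zq _] := qP z zc.
  have E1 : z = n y by apply: qn; rewrite ?E // eq_sym.
  have E2 : y = n z by apply: qn; rewrite -?E.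
  by have := nny y yc; rewrite -E1 -E2 eqxx.
split=> [y z | y]; rewrite inE => yc.
  by move=> zq zy; rewrite (qn y z yc zq zy) inE nc // par.
have pc : prev c y \in c by rewrite mem_prev.
have npy : n (prev c y) = y by rewrite /n next_prev.
exists (prev c y); first by rewrite inE.
have [_] := qP _ pc; rewrite npy => ->; rewrite andbT.
by have := ny _ pc; rewrite npy eq_sym.
Qed.

(** As long as an edge of the multigraph leaves [S], a new vertex is attached along such an edge.
    Otherwise [S] is closed under adjacency, and a vertex of degree at most 2, a pendant edge or an
    even cycle outside [S] is added. *)
Lemma pick_step S p s : pick_state S p s -> S != Y ->
  exists S' p' s', pick_state S' p' s' /\ #|S| < #|S'|.
Proof.
move=> st SY; have [sub Hadj inj alt unhit bnd] := st.
have grow (T : {set G}) z : z \in T -> z \notin S -> #|S| < #|S :|: T|.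
  move=> zT zS; apply: proper_card; apply/properP; split; first exact: subsetUl.
  by exists z; rewrite // inE zT orbT.
have [u0 /andP[u0S u0b] | nob] :=
  pickP (fun u => (u \in S) && boundary S u).
  (* By [pick_boundary] at most one boundary vertex is unhit; it is taken if it exists, and any
     boundary vertex otherwise. *)
  have [u [uS ub umax]] : exists u, [/\ u \in S, boundary S u &
      forall v, v \in S -> ~~ hit S p v -> boundary S v -> u = v].
    have [/exists_inP[v vS /andP[vb hv]]|no] := boolP [exists v in S, boundary S v && ~~ hit S p v].
      by exists v; split=> // w wS hw bw; apply: bnd.
    exists u0; split=> // v vS hv bv; case/exists_inP: no; exists v => //.
    by rewrite bv.
  case/existsP: ub => x /existsP[z /and3P[ux xz zS]].
  have uY := sub u uS; have xX := adjYX uY ux; have zY := adjXY xX xz.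
  have zx : adj z x by rewrite adj_sym.
  (* The new vertex [z] picks the edge to [u], so [u] becomes hit and no unhit vertex of [S] remains
     on the boundary. *)
  exists (S :|: [set z]); do 2!eexists; split; last exact: grow (set11 z) zS.
  apply: (pick_extend (q := fun=> x) (t := fun=> ~~ s u) st).
  - by move=> y /set1P->.
  - by move=> y /set1P->.
  - by move=> y /set1P->; left.
  - by move=> y y' /set1P-> /set1P->.
  - move=> y y' /set1P-> _ y'x y'z; right.
    have -> : y' = u by apply: (other_end xX) y'x _ y'z => //; apply: contraNneq zS => ->.
    by rewrite uS; case: (s u).
  - by move=> y y' /set1P-> /set1P->.
  move=> y v /set1P-> vS hz hv; apply: contra hv => bv.
  have [hv|hv] := boolP (hit S p v); first by apply: hit_extend => // y' /set1P->.
  apply/exists_inP; exists z; first by rewrite inE set11 orbT.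
  by rewrite set11 -(umax v vS hv bv) ux andbT; apply: contraNneq zS => ->.
have nobS v : v \in S -> ~~ boundary S v by move=> vS; have := nob v; rewrite vS /= => ->.
have SX y x z : y \in S -> adj y x -> adj z x -> z \in S.
  move=> yS yx zx; apply: contraNT (nobS y yS) => zS.
  by apply/existsP; exists x; apply/existsP; exists z; rewrite yx adj_sym zx.
(* A pendant pick, or no pick, has no other end to alternate with, so any value of [t] works. *)
have single z x : z \in Y -> z \notin S ->
    adj z x /\ (forall w, adj w x -> w = z) \/ x = z /\ degree z <= 2 ->
    exists S' p' s', pick_state S' p' s' /\ #|S| < #|S'|.
  move=> zY zS H; exists (S :|: [set z]); do 2!eexists; split; last exact: grow (set11 z) zS.
  apply: (pick_extend (q := fun=> x) (t := s) st).
  - by move=> y /set1P->.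
  - by move=> y /set1P->.
  - by move=> y /set1P->; case: H => [[]|]; auto.
  - by move=> y y' /set1P-> /set1P->.
  - move=> y y' /set1P-> zx y'x; case: H => [[_ xz]|[E _]]; first by rewrite (xz y') ?eqxx.
    by rewrite E adj_irrefl in zx.
  - by move=> y y' /set1P-> /set1P->.
  by move=> y v _ vS _ _; apply: nobS.
pose A := Y :\: S.
have AP z : (z \in A) = (z \in Y) && (z \notin S) by rewrite inE andbC.
have [/exists_inP[z]|/exists_inPn degA] := boolP [exists z in A, degree z <= 2].
  by rewrite AP => /andP[zY zS] dz; apply: (single z z) => //; right.
have [/exists_inP[z]|/exists_inPn pend] :=
  boolP [exists z in A, exists x, adj z x && [forall w, adj w x ==> (w == z)]].
  rewrite AP => /andP[zY zS] /existsP[x /andP[zx /forallP zw]]; apply: (single z x) => //; left.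
  by split=> // w wx; apply/eqP; have := zw w; rewrite wx.
have [||y yA|y x yA yx|T [q [t [T0 TA Tadj Tinj [Talt Thit]]]]] := @even_cycle_pick A.
- by move=> y; rewrite AP => /andP[].
- apply: contraNneq SY => A0; rewrite eqEsubset; apply/andP; split; apply/subsetP => // y yY.
  by apply: contraT => yS; have := in_set0 y; rewrite -A0 AP yY yS.
- by rewrite ltnNge degA.
- have /existsPn/(_ x) := pend y yA; rewrite yx /= => /forallPn[z]; rewrite negb_imply.
  case/andP=> zx zy; exists z; last by rewrite zy.
  move: yA; rewrite !AP => /andP[yY yS]; rewrite (adjXY (adjYX yY yx)) 1?adj_sym //=.
  by apply: contra yS => zS; apply: SX zS zx yx.
have TS : {in T, forall y, y \notin S} by move=> y /TA; rewrite AP => /andP[].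
have hitT y : y \in T -> hit (S :|: T) (fun y => if y \in T then q y else p y) y.
  case/Thit=> w wT wy; apply/exists_inP; exists w; first by rewrite inE wT orbT.
  by rewrite wT.
have /set0Pn[z zT] := T0.
exists (S :|: T); do 2!eexists; split; last exact: grow zT (TS z zT).
apply: (pick_extend (q := q) (t := t) st) => //.
- by move=> y /TA; rewrite AP => /andP[].
- by move=> y /Tadj; left.
- by move=> y y' yT _ y'q yy'; left; apply: Talt.
- by move=> u v uT _; rewrite hitT.
- by move=> u v uT _; rewrite hitT.
Qed.

Lemma pick_state_full : exists p s, pick_state Y p s.
Proof.
suff H n (S : {set G}) p s : #|Y| - #|S| <= n -> pick_state S p s -> exists p s, pick_state Y p s.
  by apply: (H #|Y| set0 id xpredT); rewrite ?cards0 ?subn0 //; split=> ?; rewrite ?inE.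
elim: n S p s => [|n IH] S p s Sn st.
  have [SY|/(pick_step st)[S' [p' [s' [st' lt]]]]] := eqVneq S Y; first by exists p, s; rewrite -SY.
  have /subset_leq_card : S' \subset Y by apply/subsetP; case: st'.
  lia.
have [SY|/(pick_step st)[S' [p' [s' [st' lt]]]]] := eqVneq S Y; first by exists p, s; rewrite -SY.
by apply: (IH S' p' s') => //; lia.
Qed.

(** * The coloring built from a full set of picks *)

Hypothesis degY : {in Y, forall y, degree y <= 3}.
Variables (p : G -> G) (s : G -> bool).
Hypothesis st : pick_state Y p s.

(** These edges of [G] are left to the colors 0, 1 and 2. *)
Definition rest y x := adj y x && (x != p y).

Definition picked x := [exists w in Y, p w == x].

Lemma pickedP x : reflect (exists2 w, w \in Y & p w == x) (picked x).
Proof. exact: exists_inP. Qed.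

Definition rank (v : G) : nat := enum_rank v.

(* The longest paths of [rest] edges start and end with edges picked by another
vertex. They are colored 0 1 2 0 1 0 through an unhit vertex, and 0 1 2 0
between two hit vertices; [rank] breaks the symmetry. *)
Definition rest_color y x : nat :=
  if picked x then nat_of_bool [exists x', [&& rest y x', picked x' & rank x' < rank x]]
  else if hit Y p y
  then 1 + [exists y', [&& y' != y, adj y' x, hit Y p y' & rank y' < rank y]]
  else if [exists x', rest y x' && (rank x' < rank x)] then 0 else 2.

Definition color y x : nat := if x == p y then 3 + s y else rest_color y x.

Lemma rank_ltgt u v : u != v -> rank u < rank v \/ rank v < rank u.
Proof.
move=> uv; apply/orP; rewrite -neq_ltn.
by apply: contra uv => /eqP/val_inj/enum_rank_inj->.
Qed.

Lemma rest_color_lt3 y x : rest_color y x < 3.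
Proof. by rewrite /rest_color; do 4?case: ifP => _ //; case: [exists _, _]. Qed.

Lemma color_lt5 y x : color y x < 5.
Proof.
rewrite /color; case: ifP => _; first by case: (s y).
by apply: leq_trans (rest_color_lt3 y x) _.
Qed.

Lemma color_eq y x y' x' : color y x = color y' x' ->
  (x == p y) = (x' == p y') /\
  if x == p y then s y = s y' else rest_color y x = rest_color y' x'.
Proof.
rewrite /color; have := rest_color_lt3 y x; have := rest_color_lt3 y' x'.
by case: eqP => _; case: eqP => _ // h h'; [case: (s y); case: (s y') | lia | lia].
Qed.

(** Either [y] picks one of its at most three edges, or it has degree at most 2. *)
Lemma rest_le2 y a b c : y \in Y -> rest y a -> rest y b -> rest y c ->
  a != b -> a != c -> b != c -> False.
Proof.
move=> yY /andP[ya pa] /andP[yb pb] /andP[yc pc] ab ac bc.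
have us : uniq [:: a; b; c] by rewrite /= !inE negb_or ab ac bc.
case: (pick_adj st yY) => [yp|[_ d2]].
  have := @size_le_degree y [:: p y; a; b; c]; rewrite cons_uniq us /= yp ya yb yc.
  rewrite !inE !negb_or ![p y == _]eq_sym pa pb pc => /(_ isT isT).
  by rewrite leqNgt ltnS degY.
have := @size_le_degree y [:: a; b; c]; rewrite us /= ya yb yc => /(_ isT isT).
by rewrite leqNgt ltnS d2.
Qed.

(** Since picks are injective, an edge picked by another vertex is not the pick of [y]. *)
Lemma hitP y : y \in Y -> reflect (exists2 x, rest y x & picked x) (hit Y p y).
Proof.
move=> yY; apply: (iffP exists_inP) => [[w wY /andP[wy yw]]|[x /andP[yx xp] px]].
  exists (p w); last by apply/pickedP; exists w.
  by rewrite /rest yw; apply: contra wy => /eqP/(pick_inj st wY yY)->.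
have /pickedP[w wY /eqP E] := px; exists w => //; rewrite E yx andbT.
by apply: contraNneq xp => <-; rewrite E.
Qed.

(** A picker of [x] would be one of its two ends, and neither picks it. So a picked [x] ends its
    path of [rest] edges. *)
Lemma pickedN x y y' : y \in Y -> y' \in Y -> rest y x -> rest y' x -> y != y' -> picked x = false.
Proof.
move=> yY y'Y /andP[yx xp] /andP[y'x xp'] yy'; case: pickedP => // -[w wY /eqP E].
have xX := adjYX yY yx.
case: (pick_adj st wY) => [wp|[wp _]]; last by have := notXY xX; rewrite -E wp wY.
rewrite E in wp; have wy : w != y by apply: contraNneq xp => <-; rewrite E.
have wy' := other_end xX yx y'x wp yy' wy.
by rewrite -wy' E eqxx in xp'.
Qed.

Lemma hit_or x y y' : y \in Y -> y' \in Y -> adj y x -> adj y' x -> y != y' ->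
  hit Y p y || hit Y p y'.
Proof.
move=> yY y'Y yx y'x; apply: contraNT; rewrite negb_or => /andP[hy hy'].
exact/eqP/(pick_unhit st yY y'Y hy hy' yx y'x).
Qed.

(** The rank test could succeed only through a third [rest] edge at [y]. *)
Lemma rest_color_picked y x x' : y \in Y -> rest y x -> rest y x' -> x != x' ->
  picked x -> picked x' = false -> rest_color y x = 0.
Proof.
move=> yY yx yx' xx' px px'; rewrite /rest_color px.
case: existsP => // -[a /and3P[ya pa ra]]; case: (rest_le2 yY yx yx' ya) => //.
  by apply: contraTneq ra => ->; rewrite ltnn.
by apply: contraTneq pa => <-; rewrite px'.
Qed.

Lemma rest_color_hit y y' x : y \in Y -> y' \in Y -> rest y x -> rest y' x -> y != y' ->
  hit Y p y -> ~~ hit Y p y' -> rest_color y x = 1.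
Proof.
move=> yY y'Y yx y'x yy' hy hy'; rewrite /rest_color (pickedN yY y'Y) // hy.
case: existsP => // -[a /and4P[ay ax ha _]].
case/andP: yx y'x => yx _ /andP[y'x _].
by move: hy'; rewrite -(other_end (adjYX yY yx) yx y'x ax yy' ay) ha.
Qed.

(** No [rest] edge at an unhit vertex is picked, so only the last clause of the rule applies, with
    values 0 and 2. *)
Lemma rest_color_unhit y x : y \in Y -> rest y x -> ~~ hit Y p y -> rest_color y x != 1.
Proof.
move=> yY yx hy; rewrite /rest_color (negPf hy).
case: ifP => [px|_]; last by case: ifP.
by case/hitP: hy => //; exists x.
Qed.

Lemma color_properY y x x' : y \in Y -> adj y x -> adj y x' -> x != x' -> color y x <> color y x'.
Proof.
move=> yY yx yx' xx' /color_eq[]; case: eqP => [xp|/eqP xp] /esym E.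
  by rewrite xp (eqP E) eqxx in xx'.
have rx : rest y x by rewrite /rest yx.
have rx' : rest y x' by rewrite /rest yx' E.
clear yx yx' xp E.
(* By [rest_le2], a witness of the rank test for one edge can only be the other one, so comparing
   their ranks decides it. *)
wlog lt : x x' xx' rx rx' / rank x < rank x'.
  move=> W; case: (rank_ltgt xx') => lt; first exact: W.
  by move/esym; apply: W; rewrite 1?eq_sym.
have [px|px] := boolP (picked x); have [px'|px'] := boolP (picked x').
- rewrite /rest_color px px'.
  case: existsP => [[a /and3P[ra pa la]] _|_].
    apply: (rest_le2 yY rx rx' ra) => //; first by apply: contraTneq la => <-; rewrite ltnn.
    by apply: contraTneq la => <-; rewrite -leqNgt ltnW.
  by case: existsP => // -[]; exists x; rewrite rx px.
- rewrite (rest_color_picked yY rx rx') ?(negPf px') // /rest_color (negPf px').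
  by have -> : hit Y p y by apply/hitP => //; exists x.
- rewrite (rest_color_picked yY rx' rx) ?(negPf px) 1?eq_sym // /rest_color (negPf px).
  by have -> : hit Y p y by apply/hitP => //; exists x'.
rewrite /rest_color (negPf px) (negPf px').
have /negPf -> : ~~ hit Y p y.
  apply/negP => /(hitP yY)[a ra pa]; apply: (rest_le2 yY rx rx' ra) => //.
    by apply: contraNneq px => ->.
  by apply: contraNneq px' => ->.
case: existsP => [[a /andP[ra la]] _|_].
  apply: (rest_le2 yY rx rx' ra) => //; first by apply: contraTneq la => <-; rewrite ltnn.
  by apply: contraTneq la => <-; rewrite -leqNgt ltnW.
by case: existsP => // -[]; exists x; rewrite rx.
Qed.

Lemma color_properX y y' x : y \in Y -> y' \in Y -> adj y x -> adj y' x -> y != y' ->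
  color y x <> color y' x.
Proof.
move=> yY y'Y yx y'x yy' /color_eq[]; case: eqP => [xp|/eqP xp] /esym E.
  by move/eqP: E; rewrite xp => /(pick_inj st yY y'Y) E; rewrite E eqxx in yy'.
have rx : rest y x by rewrite /rest yx.
have rx' : rest y' x by rewrite /rest y'x E.
wlog lt : y y' yY y'Y yx y'x yy' {xp E} rx rx' / rank y < rank y'.
  move=> W; case: (rank_ltgt yy') => lt; first exact: (W y y').
  by move/esym; apply: (W y' y); rewrite 1?eq_sym.
have [hy|hy] := boolP (hit Y p y); have [hy'|hy'] := boolP (hit Y p y').
- rewrite /rest_color (pickedN yY y'Y) // hy hy'.
  case: existsP => [[a /and4P[ay ax _ la]] _|_].
    by move: la; rewrite (other_end (adjYX yY yx) yx y'x ax) // ltnNge ltnW.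
  by case: existsP => // -[]; exists y; rewrite yy' yx hy.
- rewrite (rest_color_hit yY y'Y) // => /esym/eqP.
  by rewrite (negPf (rest_color_unhit y'Y _ _)).
- rewrite (rest_color_hit y'Y yY) 1?eq_sym // => /eqP.
  by rewrite (negPf (rest_color_unhit yY _ _)).
by have := hit_or yY y'Y yx y'x yy'; rewrite (negPf hy) (negPf hy').
Qed.

Lemma pick_alt_neq y z : y \in Y -> adj y (p y) -> adj z (p y) -> y != z -> s y <> s z.
Proof.
move=> yY yp zp yz E; have [|_] := pick_alt st yY yp zp; first by rewrite eq_sym.
by rewrite E eqxx.
Qed.

Lemma color_starX x0 y x1 y' x2 : y \in Y -> y' \in Y ->
  adj y x0 -> adj y x1 -> adj y' x1 -> adj y' x2 -> x0 != x1 -> y != y' -> x1 != x2 ->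
  color y x0 = color y' x1 -> color y x1 = color y' x2 -> False.
Proof.
move=> yY y'Y yx0 yx1 y'x1 y'x2 x01 yy' x12 /color_eq[E0 C0] /color_eq[E1 C1].
have [/eqP e0|n0] := boolP (x0 == p y).
  rewrite e0 eqxx in E0 C0; move/esym/eqP: E0 => E0.
  by apply: (@pick_alt_neq y' y) => //; rewrite -?E0 // eq_sym.
have [/eqP e1|n1] := boolP (x1 == p y).
  rewrite e1 eqxx in C1; by apply: (@pick_alt_neq y y') => //; rewrite -e1.
rewrite (negPf n0) in E0 C0; rewrite (negPf n1) in E1 C1.
have r0 : rest y x0 by rewrite /rest yx0.
have r1 : rest y x1 by rewrite /rest yx1.
have r1' : rest y' x1 by rewrite /rest y'x1 -E0.
have r2 : rest y' x2 by rewrite /rest y'x2 -E1.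
wlog hy : x0 x2 y y' yY y'Y yx0 yx1 y'x1 y'x2 x01 yy' x12 r0 r1 r1' r2 C0 C1
          {E0 E1 n0 n1} / hit Y p y.
  move=> W; case/orP: (hit_or yY y'Y yx1 y'x1 yy') => h; first exact: (W x0 x2 y y').
  by apply: (W x2 x0 y' y); rewrite 1?eq_sym.
have px1 : picked x1 = false by apply: (pickedN yY y'Y).
have px0 : picked x0.
  case/(hitP yY): hy => a ra pa; have [<-//|ax0] := eqVneq a x0.
  case: (rest_le2 yY r0 r1 ra); rewrite // 1?eq_sym //.
  by apply: contraTneq pa => ->; rewrite px1.
move: C0; rewrite (rest_color_picked yY r0 r1) // /rest_color px1.
case: (boolP (hit Y p y')) => // hy' _.
by have := rest_color_unhit y'Y r2 hy'; rewrite -C1 (rest_color_hit yY y'Y).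
Qed.

(** In the case of [rest] edges, neither [x] nor [x'] is picked by [pickedN], so the center [y'] is
    unhit and [y] is hit. Hence [x] has color 1 at [y], a color missing at [y']. *)
Lemma color_starY y x y' x' y'' : y \in Y -> y' \in Y -> y'' \in Y ->
  adj y x -> adj y' x -> adj y' x' -> adj y'' x' -> y != y' -> x != x' -> y' != y'' ->
  color y x = color y' x' -> color y' x = color y'' x' -> False.
Proof.
move=> yY y'Y y''Y yx y'x y'x' y''x' yy' xx' y'y'' /color_eq[E0 C0] /color_eq[E1 C1].
have [/eqP e0|n0] := boolP (x == p y).
  rewrite e0 eqxx in C0; by apply: (@pick_alt_neq y y') => //; rewrite -e0.
have [/eqP e1|n1] := boolP (x == p y').
  rewrite e1 eqxx in E1 C1; move/esym/eqP: E1 => E1.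
  by apply: (@pick_alt_neq y'' y') => //; rewrite -?E1 // eq_sym.
rewrite (negPf n0) in E0 C0; rewrite (negPf n1) in E1.
have r0 : rest y x by rewrite /rest yx.
have r1 : rest y' x by rewrite /rest y'x.
have r1' : rest y' x' by rewrite /rest y'x' -E0.
have r2 : rest y'' x' by rewrite /rest y''x' -E1.
have hy' : ~~ hit Y p y'.
  apply/negP => /(hitP y'Y)[a ra pa]; apply: (rest_le2 y'Y r1 r1' ra) => //.
    by apply: contraTneq pa => <-; rewrite (pickedN yY y'Y r0 r1).
  by apply: contraTneq pa => <-; rewrite (pickedN y'Y y''Y r1' r2).
have hy : hit Y p y by have := hit_or yY y'Y yx y'x yy'; rewrite (negPf hy') orbF.
by have := rest_color_unhit y'Y r1' hy'; rewrite -C0 (rest_color_hit yY y'Y).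
Qed.

End Picks.

Theorem theorem9 (G : sgraph) (X Y : {set G}) :
  bipartition X Y -> max_degree X = 2 -> max_degree Y = 3 ->
  star_chromatic_index G <= 5.
Proof.
move=> bip dX dY.
have degX : {in X, forall x, degree x <= 2} by move=> x xX; rewrite -dX; apply: leq_bigmax_cond.
have degY : {in Y, forall x, degree x <= 3} by move=> x xY; rewrite -dY; apply: leq_bigmax_cond.
have [p [s st]] := pick_state_full bip degX.
pose k := color Y p s.
(* The test orients each edge from [Y] to [X]; [inord] is faithful by [color_lt5]. *)
pose d u v : 'I_5 := inord (if u \in Y then k u v else k v u).
have dE y x : y \in Y -> adj y x -> nat_of_ord (d y x) = k y x /\ nat_of_ord (d x y) = k y x.
  move=> yY yx; rewrite /d yY (negPf (notXY bip (adjYX bip yY yx))).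
  by rewrite inordK ?color_lt5.
have ends u v : adj u v -> u \in Y /\ v \in X \/ u \in X /\ v \in Y.
  by case: bip => _ _ H /H /orP[] /andP[]; auto.
have YX y x : y \in Y -> adj y x -> x \in X by apply: adjYX.
have XY x y : x \in X -> adj x y -> y \in Y by apply: adjXY.
apply: (star_chromatic_index_le (d := d)).
- move=> u v uv; apply: val_inj => /=; have vu : adj v u by rewrite adj_sym.
  by case: (ends u v uv) => -[hu hv]; [case: (dE u v hu uv) | case: (dE v u hv vu)] => -> ->.
- move=> u v w uv vw uw; apply/eqP => /(congr1 val) /=.
  have vu : adj v u by rewrite adj_sym.
  have wv : adj w v by rewrite adj_sym.
  case: (ends u v uv) => -[hu hv].
    have hw := XY v w hv vw.
    rewrite (dE u v hu uv).1 (dE w v hw wv).2.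
    exact: (color_properX bip degX st).
  rewrite (dE v u hv vu).2 (dE v w hv vw).1.
  exact: (color_properY degY st).
move=> u v w z a uv vw wz za uw vz wa /(congr1 val) /= E1 /(congr1 val) /= E2.
have [vu wv zw az] : [/\ adj v u, adj w v, adj z w & adj a z] by split; rewrite adj_sym.
(* The center [w] lies on the same side as [u], which decides between [color_starY] and
   [color_starX]. *)
case: (ends u v uv) => -[hu hv].
  have hw := XY v w hv vw; have hz := YX w z hw wz; have ha := XY z a hz za.
  move: E1 E2; rewrite (dE u v hu uv).1 (dE w v hw wv).2 (dE w z hw wz).1 (dE a z ha az).2.
  exact: (color_starY bip degX degY st).
have hw := YX v w hv vw; have hz := XY w z hw wz.
move: E1 E2; rewrite (dE v u hv vu).2 (dE v w hv vw).1 (dE z w hz zw).2 (dE z a hz za).1.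
exact: (color_starX bip degX degY st).
Qed.
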